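(* Let $X^n$ and $Y^n$ be the inputs and outputs of a discrete channel with noisy feedback and let $W$ be the message. Then $$I(W;Y^n)=I^R(X^n(W)\rightarrow Y^n)=I(X^n\rightarrow Y^n)-I(X^n\rightarrow Y^n|W).$$
   Context: All random variables take values in finite sets. Notation: $x^n=(x_1,\dots,x_n)$, $x^0=\emptyset$. Channel with noisy feedback: a message $W$ is drawn from $\{1,\dots,M\}$. The random variables are generated in the order $W,X_1,Y_1,Z_1,X_2,Y_2,Z_2,\dots,X_n,Y_n$. At time $i$ a deterministic encoder produces the channel input $X_i$ as a function of $(W,Z^{i-1})$. The channel output $Y_i$ is generated, given all of the past, according to $p(y_i|x^i,y^{i-1})$. The feedback link output $Z_i$ is generated, given all of the past, according to $p(z_i|y^i,z^{i-1})$. Directed information: $I(X^n\rightarrow Y^n)=\sum_{i=1}^n I(X^i;Y_i|Y^{i-1})$. Conditional on the message: $I(X^n\rightarrow Y^n|W)=\sum_{i=1}^n I(X^i;Y_i|Y^{i-1},W)$. Residual directed information: $I^R(X^n(W)\rightarrow Y^n):=I(X^n\rightarrow Y^n)-I(X^n\rightarrow Y^n|W)$. *)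

(* Defs.v *)
From mathcomp Require Import all_boot all_order all_algebra.
From mathcomp Require Import all_classical all_reals all_analysis.

Set Implicit Arguments.
Unset Strict Implicit.
Unset Printing Implicit Defensive.

Import Order.TTheory GRing.Theory Num.Theory.
Local Open Scope classical_set_scope.
Local Open Scope ring_scope.

Section FiniteRandomVariables.
Context (d : measure_display) (Omega : measurableType d) (R : realType).

(* Measurability for the discrete sigma-algebra on the finite codomain. *)
Definition finite_rv (aT : finType) (A : Omega -> aT) : Prop :=
  forall a : aT, measurable (A @^-1` [set a]).

Definition joint (aT bT : finType) (A : Omega -> aT) (B : Omega -> bT) :
  Omega -> aT * bT := fun omega => (A omega, B omega).

(* Processes are indexed from 0, so [block U k] consists of the first k
   variables, written U^k in 1-based notation. *)
Definition block (aT : finType) (U : nat -> Omega -> aT) (k : nat) :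
  Omega -> k.-tuple aT := fun omega => [tuple U j omega | j < k].

Context (P : probability Omega R).

Definition pmf (aT : finType) (A : Omega -> aT) (a : aT) : R :=
  fine (P (A @^-1` [set a])).

(* Equals 0 when the conditioning event has probability 0. *)
Definition cpmf (aT cT : finType) (A : Omega -> aT) (C : Omega -> cT)
    (a : aT) (c : cT) : R :=
  pmf (joint A C) (a, c) / pmf C c.

(* [b] is the base of the logarithm; [ln] is total, so terms of probability 0
   contribute 0. *)
Definition mutual_info (b : R) (aT bT : finType)
    (A : Omega -> aT) (B : Omega -> bT) : R :=
  \sum_(x : aT) \sum_(y : bT)
    pmf (joint A B) (x, y) *
    (ln (pmf (joint A B) (x, y) / (pmf A x * pmf B y)) / ln b).

Definition cond_mutual_info (b : R) (aT bT cT : finType)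
    (A : Omega -> aT) (B : Omega -> bT) (C : Omega -> cT) : R :=
  \sum_(x : aT) \sum_(y : bT) \sum_(z : cT)
    pmf (joint (joint A B) C) ((x, y), z) *
    (ln (cpmf (joint A B) C (x, y) z / (cpmf A C x z * cpmf B C y z)) / ln b).

Definition directed_info (b : R) (xT yT : finType) (n : nat)
    (X : nat -> Omega -> xT) (Y : nat -> Omega -> yT) : R :=
  \sum_(i < n) cond_mutual_info b (block X i.+1) (Y i) (block Y i).

Definition cond_directed_info (b : R) (wT xT yT : finType) (n : nat)
    (X : nat -> Omega -> xT) (Y : nat -> Omega -> yT) (W : Omega -> wT) : R :=
  \sum_(i < n) cond_mutual_info b (block X i.+1) (Y i) (joint (block Y i) W).

Definition residual_directed_info (b : R) (wT xT yT : finType) (n : nat)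
    (X : nat -> Omega -> xT) (Y : nat -> Omega -> yT) (W : Omega -> wT) : R :=
  directed_info b n X Y - cond_directed_info b n X Y W.

(* [A] is generated, given the past [H], according to the kernel [k]. *)
Definition generated_from (aT hT : finType) (A : Omega -> aT) (H : Omega -> hT)
    (k : hT -> aT -> R) : Prop :=
  forall (h : hT) (a : aT), pmf H h != 0 -> cpmf A H a h = k h a.

End FiniteRandomVariables.

Definition is_pmf (R : realType) (aT : finType) (f : aT -> R) : Prop :=
  (forall a : aT, 0 <= f a) /\ \sum_(a : aT) f a = 1.

(* The variables are generated in the order W, X 0, Y 0, Z 0, X 1, Y 1, Z 1, ...,
   X n.-1, Y n.-1: in particular only Z 0, ..., Z n.-2 are constrained. The time
   index of the encoder and of the two kernels is the first argument; it also
   fixes the lengths of the strings they depend on. *)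
Record noisy_feedback_channel (d : measure_display) (Omega : measurableType d)
    (R : realType) (P : probability Omega R) (M : nat) (xT yT zT : finType)
    (n : nat)
    (enc : forall i : nat, 'I_M -> i.-tuple zT -> xT)
    (p : forall i : nat, i.+1.-tuple xT -> i.-tuple yT -> yT -> R)
    (q : forall i : nat, i.+1.-tuple yT -> i.-tuple zT -> zT -> R)
    (W : Omega -> 'I_M) (X : nat -> Omega -> xT) (Y : nat -> Omega -> yT)
    (Z : nat -> Omega -> zT) : Prop := NoisyFeedbackChannel {
  nfc_W_rv : finite_rv W;
  nfc_X_rv : forall i : nat, (i < n)%N -> finite_rv (X i);
  nfc_Y_rv : forall i : nat, (i < n)%N -> finite_rv (Y i);
  nfc_Z_rv : forall i : nat, (i.+1 < n)%N -> finite_rv (Z i);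
  nfc_p_pmf : forall i : nat, (i < n)%N ->
    forall (x : i.+1.-tuple xT) (y : i.-tuple yT), is_pmf (p i x y);
  nfc_q_pmf : forall i : nat, (i.+1 < n)%N ->
    forall (y : i.+1.-tuple yT) (z : i.-tuple zT), is_pmf (q i y z);
  nfc_encoder : forall i : nat, (i < n)%N ->
    forall omega : Omega, X i omega = enc i (W omega) (block Z i omega);
  nfc_channel : forall i : nat, (i < n)%N ->
    generated_from P (Y i)
      (joint (joint (joint W (block X i.+1)) (block Y i)) (block Z i))
      (fun h => p i h.1.1.2 h.1.2);
  nfc_feedback : forall i : nat, (i.+1 < n)%N ->
    generated_from P (Z i)
      (joint (joint (joint W (block X i.+1)) (block Y i.+1)) (block Z i))
      (fun h => q i h.1.2 h.2)
}.

(* Main.v *)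
(* Let h(A) = E[ln p(A)] be the negative entropy. Writing conditional mutual
   informations through h, I(X^i;Y_i|Y^(i-1)) - I(X^i;Y_i|Y^(i-1),W) equals
   D_i - D_(i-1) with D_i = h(Y^i,W) - h(Y^i), provided that
   H(Y_i|X^i,Y^(i-1)) = H(Y_i|X^i,Y^(i-1),W). The latter holds because the law of
   Y_i given the whole past depends on (X^i,Y^(i-1)) only; neither the encoder nor
   the law of the feedback link matters. The sum telescopes to D_n - D_0 = I(W;Y^n). *)
Require Import Defs.
From mathcomp Require Import all_boot all_order all_algebra.
From mathcomp Require Import ring lra.
From mathcomp Require Import all_classical all_reals all_analysis.

Set Implicit Arguments.
Unset Strict Implicit.
Unset Printing Implicit Defensive.

Import Order.TTheory GRing.Theory Num.Theory.
Local Open Scope classical_set_scope.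
Local Open Scope ring_scope.

(* [probability] also exports a [pmf]. *)
Local Notation pmf := Defs.pmf.

Section FiniteRandomVariables.
Context (d : measure_display) (Omega : measurableType d).

Lemma finite_rv_comp (aT bT : finType) (A : Omega -> aT) (f : aT -> bT) :
  finite_rv A -> finite_rv (f \o A).
Proof.
move=> mA c; rewrite (_ : _ @^-1` _ = \bigcup_(a in f @^-1` [set c]) A @^-1` [set a]).
  by apply: fin_bigcup_measurable => // a _; exact: mA.
apply/seteqP; split => [w /= fAw|w [a /= fa ->]//].
by exists (A w).
Qed.

Lemma finite_rv_joint (aT bT : finType) (A : Omega -> aT) (B : Omega -> bT) :
  finite_rv A -> finite_rv B -> finite_rv (joint A B).
Proof.
move=> mA mB [a c].
rewrite (_ : _ @^-1` _ = A @^-1` [set a] `&` B @^-1` [set c]); first exact: measurableI.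
by apply/seteqP; split => w; rewrite /joint /= => -[-> ->].
Qed.

(** Allows induction on blocks. The newest variable comes first in the pair, the shape in which a
    variable generated from its past appears below. *)
Lemma blockS (aT : finType) (U : nat -> Omega -> aT) (k : nat) :
  block U k.+1 = (fun t => rcons_tuple t.2 t.1) \o joint (U k) (block U k).
Proof.
apply/funext => w; apply: eq_from_tnth => i; rewrite tnth_mktuple /=.
rewrite (tnth_nth (U k w)) /= nth_rcons size_tuple card_ord.
case: ltnP => [ik|ki]; last first.
  have -> : i = k :> nat by apply/anti_leq; rewrite -ltnS ltn_ord.
  by rewrite eqxx.
exact: esym (nth_mktuple (fun j : 'I_k => U j w) (U k w) (Ordinal ik)).
Qed.

Lemma finite_rv_block (aT : finType) (U : nat -> Omega -> aT) (k : nat) :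
  (forall i, (i < k)%N -> finite_rv (U i)) -> finite_rv (block U k).
Proof.
elim: k => [_ a|k IHk mU].
  rewrite (_ : _ @^-1` _ = setT) //.
  by apply/seteqP; split => // w _ /=; rewrite [LHS]tuple0 [RHS]tuple0.
rewrite blockS; apply/finite_rv_comp/finite_rv_joint; first exact: mU.
by apply: IHk => i ik; exact/mU/ltnW.
Qed.

Context (R : realType) (P : probability Omega R).

Lemma pmf_ge0 (aT : finType) (A : Omega -> aT) (a : aT) : 0 <= pmf P A a.
Proof. exact: fine_ge0. Qed.

Lemma pmf_comp (aT bT : finType) (A : Omega -> aT) (f : aT -> bT) (c : bT) :
  finite_rv A -> pmf P (f \o A) c = \sum_(a | f a == c) pmf P A a.
Proof.
move=> mA; rewrite /pmf.
rewrite (_ : _ @^-1` _ = \bigcup_(a in [set` [pred a | f a == c]]) A @^-1` [set a]).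
  rewrite measure_fin_bigcup//.
    rewrite -(bigfs _ (r := index_enum aT)) ?index_enum_uniq//.
      by rewrite sum_fine// => a _; apply: fin_num_measure; exact: mA.
    by move=> a; rewrite mem_index_enum.
  by move=> a a' _ _ [w [/= <- <-]].
apply/seteqP; split => [w /= fAw|w [a /= /eqP fa ->]//].
by exists (A w) => //=; apply/eqP.
Qed.

Lemma le_pmf_comp (aT bT : finType) (A : Omega -> aT) (f : aT -> bT) (a : aT) :
  finite_rv A -> pmf P A a <= pmf P (f \o A) (f a).
Proof.
move=> mA; rewrite pmf_comp// (bigD1 a)//= lerDl.
by apply: sumr_ge0 => a' _; exact: pmf_ge0.
Qed.

(** Marginals stay positive on the support, so logarithms of quotients may be split there. *)
Lemma pmf_comp_gt0 (aT bT : finType) (A : Omega -> aT) (f : aT -> bT) (a : aT) :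
  finite_rv A -> 0 < pmf P A a -> 0 < pmf P (f \o A) (f a).
Proof. by move=> mA /lt_le_trans; apply; exact: le_pmf_comp. Qed.

(** Change of variables: both sides are the expectation of [g (f A)], the right one grouped along
    the fibres of [f]. *)
Lemma sum_pmf_comp (aT bT : finType) (A : Omega -> aT) (f : aT -> bT)
    (g : bT -> R) : finite_rv A ->
  \sum_c pmf P (f \o A) c * g c = \sum_a pmf P A a * g (f a).
Proof.
move=> mA; rewrite [RHS](partition_big f xpredT)//=.
apply: eq_bigr => c _; rewrite pmf_comp// mulr_suml.
by apply: eq_bigr => a /eqP ->.
Qed.

Definition neg_entropy (aT : finType) (A : Omega -> aT) : R :=
  \sum_a pmf P A a * ln (pmf P A a).

(** Brings the entropies of several marginals under one sum over the joint law, to be compared term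
    by term. *)
Lemma neg_entropy_comp (aT bT : finType) (A : Omega -> aT) (f : aT -> bT) :
  finite_rv A ->
  neg_entropy (f \o A) = \sum_a pmf P A a * ln (pmf P (f \o A) (f a)).
Proof. by move=> mA; rewrite /neg_entropy sum_pmf_comp. Qed.

(** Relabelling values changes no probability; used to permute and reassociate tuples of
    variables. *)
Lemma neg_entropy_inj (aT bT : finType) (A : Omega -> aT) (f : aT -> bT) :
  finite_rv A -> injective f -> neg_entropy (f \o A) = neg_entropy A.
Proof.
move=> mA injf; rewrite neg_entropy_comp//; apply: eq_bigr => a _.
congr (_ * ln _); rewrite /pmf; congr (fine (P _)).
by apply/seteqP; split => w /=; [exact: injf|move=> ->].
Qed.

Lemma neg_entropy_block0 (aT : finType) (U : nat -> Omega -> aT) :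
  neg_entropy (block U 0) = 0.
Proof.
rewrite /neg_entropy big1// => a _.
rewrite /pmf (_ : _ @^-1` _ = setT) ?probability_setT ?ln1 ?mulr0//.
by apply/seteqP; split => // w _ /=; rewrite [LHS]tuple0 [RHS]tuple0.
Qed.

Lemma neg_entropy_blockS (aT : finType) (U : nat -> Omega -> aT) (k : nat) :
  (forall i, (i < k.+1)%N -> finite_rv (U i)) ->
  neg_entropy (block U k.+1) = neg_entropy (joint (U k) (block U k)).
Proof.
move=> mU; rewrite blockS neg_entropy_inj//.
  apply: finite_rv_joint; first exact: mU.
  by apply: finite_rv_block => i ik; exact/mU/ltnW.
move=> [a t] [a' t'] /(congr1 val) /= /rcons_inj [/val_inj -> ->] //.
Qed.

Lemma mutual_infoE (b : R) (aT bT : finType) (A : Omega -> aT) (B : Omega -> bT) :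
  finite_rv A -> finite_rv B ->
  mutual_info P b A B =
  (neg_entropy (joint A B) - neg_entropy A - neg_entropy B) / ln b.
Proof.
move=> mA mB; have mAB := finite_rv_joint mA mB.
rewrite (@neg_entropy_comp _ _ (joint A B) fst)//.
rewrite (@neg_entropy_comp _ _ (joint A B) snd)//.
rewrite /mutual_info pair_bigA/= -!sumrB mulr_suml; apply: eq_bigr => -[x y] _ /=.
rewrite mulrA -!mulrBr; congr (_ / _).
(* Terms of probability 0 vanish on both sides, whatever the value of [ln]. *)
have [|p_gt0|p0] := ltgtP (pmf P (joint A B) (x, y)) 0; last by rewrite p0 !mul0r.
  by rewrite ltNge pmf_ge0.
have A0 : 0 < pmf P A x := pmf_comp_gt0 fst mAB p_gt0.
have B0 : 0 < pmf P B y := pmf_comp_gt0 snd mAB p_gt0.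
by rewrite ln_div ?lnM ?posrE ?mulr_gt0// opprD addrA.
Qed.

(** The triple is ordered so that its first and third terms form -H(B|A,C), the quantity that the
    channel law controls. *)
Lemma cond_mutual_infoE (b : R) (aT bT cT : finType)
    (A : Omega -> aT) (B : Omega -> bT) (C : Omega -> cT) :
  finite_rv A -> finite_rv B -> finite_rv C ->
  cond_mutual_info P b A B C =
  (neg_entropy (joint B (joint A C)) + neg_entropy C
   - neg_entropy (joint A C) - neg_entropy (joint B C)) / ln b.
Proof.
move=> mA mB mC; have mABC := finite_rv_joint (finite_rv_joint mA mB) mC.
set V := joint (joint A B) C in mABC *.
rewrite (@neg_entropy_inj _ _ V (fun v => (v.1.2, (v.1.1, v.2))))//; last first.
  by move=> [[? ?] ?] [[? ?] ?] [-> -> ->].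
rewrite (@neg_entropy_comp _ _ V snd)//.
rewrite (@neg_entropy_comp _ _ V (fun v => (v.1.1, v.2)))//.
rewrite (@neg_entropy_comp _ _ V (fun v => (v.1.2, v.2)))//.
rewrite /cond_mutual_info pair_bigA/= pair_bigA/=.
rewrite -big_split -!sumrB mulr_suml; apply: eq_bigr => -[[x y] z] _ /=.
rewrite mulrA -mulrDr -!mulrBr; congr (_ / _); rewrite -/V.
have [|p_gt0|p0] := ltgtP (pmf P V (x, y, z)) 0; last by rewrite p0 !mul0r.
  by rewrite ltNge pmf_ge0.
have C0 : 0 < pmf P C z := pmf_comp_gt0 snd mABC p_gt0.
have AC0 : 0 < pmf P (joint A C) (x, z) :=
  pmf_comp_gt0 (fun v => (v.1.1, v.2)) mABC p_gt0.
have BC0 : 0 < pmf P (joint B C) (y, z) :=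
  pmf_comp_gt0 (fun v => (v.1.2, v.2)) mABC p_gt0.
rewrite /cpmf -/V; congr (_ * _).
rewrite !(ln_div, lnM) ?posrE ?mulr_gt0 ?divr_gt0 ?invr_gt0//.
have cancel_ln (u v w t : R) : u - v - (w - v + (t - v)) = u + v - w - t by ring.
exact: cancel_ln.
Qed.

(** Where [H] has probability 0 the kernel is unconstrained, but the joint probability is then 0 as
    well. *)
Lemma generated_from_pmf (aT hT : finType) (A : Omega -> aT) (H : Omega -> hT)
    (k : hT -> aT -> R) : finite_rv A -> finite_rv H ->
  generated_from P A H k ->
  forall a h, pmf P (joint A H) (a, h) = k h a * pmf P H h.
Proof.
move=> mA mH gk a h; have [h0|h0] := eqVneq (pmf P H h) 0.
  rewrite h0 mulr0; apply/eqP; rewrite eq_le pmf_ge0 -[X in _ <= X]h0 andbT.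
  exact: (@le_pmf_comp _ _ (joint A H) snd (a, h) (finite_rv_joint mA mH)).
by rewrite -(gk h a h0) /cpmf divfK.
Qed.

Lemma neg_entropy_kernel (aT hT : finType) (A : Omega -> aT) (H : Omega -> hT)
    (k : hT -> aT -> R) : finite_rv A -> finite_rv H ->
  (forall a h, pmf P (joint A H) (a, h) = k h a * pmf P H h) ->
  neg_entropy (joint A H) - neg_entropy H =
  \sum_v pmf P (joint A H) v * ln (k v.2 v.1).
Proof.
move=> mA mH kE; have mAH := finite_rv_joint mA mH.
rewrite (@neg_entropy_comp _ _ (joint A H) snd)// -sumrB.
apply: eq_bigr => -[a h] _ /=; rewrite -mulrBr.
have [|p_gt0|p0] := ltgtP (pmf P (joint A H) (a, h)) 0; last by rewrite p0 !mul0r.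
  by rewrite ltNge pmf_ge0.
have H0 : 0 < pmf P H h := pmf_comp_gt0 snd mAH p_gt0.
have k0 : 0 < k h a by move: p_gt0; rewrite kE pmulr_lgt0.
by rewrite kE lnM ?posrE// addrK.
Qed.

(* If the kernel generating A from the past H only depends on f(H), both sides
   are the expectation of its logarithm: -H(A|H) = -H(A|f(H)). *)
Lemma neg_entropy_generated_from (aT hT gT : finType) (A : Omega -> aT)
    (H : Omega -> hT) (f : hT -> gT) (k : gT -> aT -> R) :
  finite_rv A -> finite_rv H -> generated_from P A H (fun h => k (f h)) ->
  neg_entropy (joint A H) - neg_entropy H =
  neg_entropy (joint A (f \o H)) - neg_entropy (f \o H).
Proof.
move=> mA mH /(generated_from_pmf mA mH) kE.
have mAH := finite_rv_joint mA mH; have mfH := finite_rv_comp f mH.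
pose F (v : aT * hT) := (v.1, f v.2).
rewrite (neg_entropy_kernel mA mH kE) (neg_entropy_kernel (k := k) mA mfH).
  by rewrite -[joint A (f \o H)]/(F \o joint A H) sum_pmf_comp.
(* The kernel is constant on the fibres of [f], so summing the product formula over [f h = g] gives
   it for [f \o H]. *)
move=> a g; rewrite -[joint A (f \o H)]/(F \o joint A H) !pmf_comp// mulr_sumr.
rewrite (reindex_onto (pair a) snd) /=; last first.
  by move=> [a' h] /eqP [-> _].
apply: eq_big => [h|h /andP[/eqP[<-] _]]; last by rewrite kE.
by rewrite /F xpair_eqE /= !eqxx andbT.
Qed.

End FiniteRandomVariables.

Theorem theorem1 (d : measure_display) (Omega : measurableType d)
    (R : realType) (P : probability Omega R)
    (b : R) (b_gt1 : 1 < b)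
    (M : nat) (xT yT zT : finType) (n : nat)
    (enc : forall i : nat, 'I_M -> i.-tuple zT -> xT)
    (p : forall i : nat, i.+1.-tuple xT -> i.-tuple yT -> yT -> R)
    (q : forall i : nat, i.+1.-tuple yT -> i.-tuple zT -> zT -> R)
    (W : Omega -> 'I_M) (X : nat -> Omega -> xT) (Y : nat -> Omega -> yT)
    (Z : nat -> Omega -> zT)
    (hch : noisy_feedback_channel P n enc p q W X Y Z) :
  mutual_info P b W (block Y n) = residual_directed_info P b n X Y W /\
  residual_directed_info P b n X Y W =
    directed_info P b n X Y - cond_directed_info P b n X Y W.
Proof.
split=> //; case: hch => mW mX mY mZ _ _ _ channel _.
have mYk k : (k <= n)%N -> finite_rv (block Y k).
  by move=> kn; apply: finite_rv_block => i ik; apply: mY; exact: leq_trans kn.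
have mYW k (kn : (k <= n)%N) := finite_rv_joint (mYk k kn) mW.
(* [D k] is -H(W|Y^k) in nats, so its increments are the terms I(W;Y_i|Y^(i-1)) of the chain
   rule. *)
pose D k := neg_entropy P (joint (block Y k) W) - neg_entropy P (block Y k).
have step (i : 'I_n) : cond_mutual_info P b (block X i.+1) (Y i) (block Y i) -
    cond_mutual_info P b (block X i.+1) (Y i) (joint (block Y i) W) =
    (D i.+1 - D i) / ln b.
  have iltn := ltn_ord i; have ilen := ltnW iltn.
  have mXi : finite_rv (block X i.+1).
    by apply: finite_rv_block => j ji; apply: mX; exact: leq_trans ji iltn.
  have mZi : finite_rv (block Z i).
    (* Only [Z j] with [j < i] occurs, hence [j.+1 < n]. *)
    by apply: finite_rv_block => j ji; apply: mZ; exact: leq_ltn_trans ji iltn.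
  have mH := finite_rv_joint
    (finite_rv_joint (finite_rv_joint mW mXi) (mYk _ ilen)) mZi.
  (* The past is coarsened in two ways, to (X^i,Y^(i-1)) and to (X^i,Y^(i-1),W). Both give the same
     conditional entropy of Y_i; equating them is [markov]. *)
  have := neg_entropy_generated_from (f := fun h => (h.1.1.2, h.1.2))
    (k := fun g => p i g.1 g.2) (mY _ iltn) mH (channel _ iltn).
  rewrite (neg_entropy_generated_from
    (f := fun h => (h.1.1.2, (h.1.2, h.1.1.1)))
    (k := fun g => p i g.1 g.2.1) (mY _ iltn) mH (channel _ iltn)).
  set H := joint _ (block Z i).
  rewrite -[(fun h => (h.1.1.2, h.1.2)) \o H]/(joint (block X i.+1) (block Y i)).
  rewrite -[_ \o H]/(joint (block X i.+1) (joint (block Y i) W)) => markov.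
  rewrite !cond_mutual_infoE//; [|exact: mY|exact: mYW|exact: mY|exact: mYk].
  rewrite -mulrBl /D; congr (_ / _).
  rewrite (neg_entropy_blockS P (U := Y)); last first.
    by move=> j ji; apply: mY; exact: leq_trans ji iltn.
  have -> : neg_entropy P (joint (block Y i.+1) W) =
      neg_entropy P (joint (Y i) (joint (block Y i) W)).
    rewrite blockS.
    rewrite -(@neg_entropy_inj _ _ _ _ _ _ (joint (Y i) (joint (block Y i) W))
      (fun v => (rcons_tuple v.2.1 v.1, v.2.2)))//.
      by apply: finite_rv_joint; [exact: mY|exact: mYW].
    by move=> [y [t w]] [y' [t' w']] [/rcons_inj [/val_inj -> ->] ->].
  (* By [markov] the terms containing X^i cancel, leaving the increment of [D]. *)
  by lra.
rewrite /residual_directed_info /directed_info /cond_directed_info -sumrB.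
under eq_bigr do rewrite step.
rewrite -mulr_suml -(big_mkord xpredT (fun i => D i.+1 - D i)) telescope_sumr//.
rewrite mutual_infoE//; last exact: mYk.
(* Since Y^0 is constant, [D 0] reduces to the negative entropy of [W]. *)
congr (_ / _); rewrite /D neg_entropy_block0.
have -> : neg_entropy P (joint (block Y 0) W) = neg_entropy P W.
  rewrite -(@neg_entropy_inj _ _ _ P _ _ (joint (block Y 0) W) snd) //.
    exact: mYW.
  by move=> [t w] [t' w'] /= ->; rewrite (tuple0 t) (tuple0 t').
rewrite -(@neg_entropy_inj _ _ _ P _ _ (joint (block Y n) W) (fun v => (v.2, v.1)))//.
- by rewrite -[_ \o _]/(joint W (block Y n)); lra.
- exact: mYW.
- by move=> [? ?] [? ?] [-> ->].
Qed.
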